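(* Let $G$ be a $3$-homogeneous permutation group on the set $\{1,\ldots,n\}$. Then the number of $G$-orbits on the set of $(n-3)$-partitions is $O(n)$ for partitions of type $(4,1,\ldots,1)$, $O(n^2)$ for partitions of type $(3,2,1,\ldots,1)$, and $O(n^3)$ for partitions of type $(2,2,2,1,\ldots,1)$.
   Context: A permutation group on $\{1,\ldots,n\}$ is $3$-homogeneous if it has only one orbit on $3$-subsets. An $(n-3)$-partition is a partition of the set $\{1,\ldots,n\}$ into exactly $n-3$ parts; its type is the non-increasing sequence of its part sizes. The constants implied by the $O$-notation are absolute (independent of $n$ and $G$). *)

(* Defs.v *)
From mathcomp Require Import all_boot all_fingroup.

Set Implicit Arguments.
Unset Strict Implicit.
Unset Printing Implicit Defensive.

Local Open Scope nat_scope.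

(* Transitivity here requires at least one k-subset, so that there is exactly
   one orbit. *)
Definition homogeneous (n k : nat) (G : {group {perm 'I_n}}) : bool :=
  [transitive G, on [set A : {set 'I_n} | #|A| == k] | 'P^*].

Definition kpartitions (n k : nat) : {set {set {set 'I_n}}} :=
  [set P : {set {set 'I_n}} | partition P [set: 'I_n] & #|P| == k].

Definition partition_type (n : nat) (P : {set {set 'I_n}}) : seq nat :=
  sort geq [seq #|B| | B : {set 'I_n} in P].

Definition kpartitions_of_type (n k : nat) (lam : seq nat) :
    {set {set {set 'I_n}}} :=
  [set P in kpartitions n k | partition_type P == lam].

(* 'P^*^* is the action g |-> {g(B) | B in P} induced on sets of subsets. *)
Definition num_partition_orbits (n : nat) (G : {group {perm 'I_n}})
    (k : nat) (lam : seq nat) : nat :=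
  #|orbit ('P^*^*)%act G @: kpartitions_of_type n k lam|.

(* Main.v *)
Require Import Defs.
From mathcomp Require Import all_boot all_fingroup.

Set Implicit Arguments.
Unset Strict Implicit.
Unset Printing Implicit Defensive.

Local Open Scope nat_scope.

(** A partition of an [n]-set into [n - r] parts is the partition into fibres
    of a retraction: choose one representative in each part and send every
    point to the representative of its part.  Only the [r]-set [A] of points
    that are not representatives is moved, and [A] meets only parts of size at
    least 2.  Hence, if the type has [k] entries larger than 1, the retraction
    takes at most [k] values on [A]; it is recovered from [A], a list of [k]
    points, and a map from [A] to the positions of that list
    ([partition_retraction], [preim_partition_collapse]).

    If [G] is [r]-homogeneous, then some element of [G] carries [A] to a fixed
    [r]-set [A0], so that every orbit contains a partition for which [A = A0].
    What is left to choose are the list and the map, whence at most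
    [k ^ r * n ^ k] orbits ([num_partition_orbits_le]).  The three types of the
    theorem have [r = 3] and [k = 1, 2, 3]. *)

Lemma eq_preim_partition (T : finType) (rT1 rT2 : eqType)
    (f1 : T -> rT1) (f2 : T -> rT2) (D : {set T}) :
  (forall x y, (f1 x == f1 y) = (f2 x == f2 y)) ->
  preim_partition f1 D = preim_partition f2 D.
Proof.
move=> eqf; apply: eq_imset => x; apply/setP=> y.
by rewrite !inE eqf.
Qed.

(** Only points outside a transversal are moved, and a moved point shares its
    part with its representative; so the values taken at moved points are
    representatives of parts of size at least 2. *)
Lemma partition_retraction (T : finType) (x0 : T) (P : {set {set T}}) :
  partition P [set: T] ->
  exists (A : {set T}) (f : T -> T),
    [/\ #|A| = #|T| - #|P|, {in ~: A, f =1 id},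
        #|f @: A| <= #|[set B in P | 1 < #|B|]|
      & P = preim_partition f [set: T]].
Proof.
move=> partP; have trX := transversalP partP.
set X := transversal P setT in trX.
have [/eqP covP _ _] := and3P partP.
have memP x : pblock P x \in P by rewrite pblock_mem // covP inE.
exists (~: X), (fun x => transversal_repr x0 X (pblock P x)); split.
- by rewrite cardsCs setCK (card_transversal trX).
- by move=> x; rewrite setCK => Xx; rewrite /= (pblockK trX).
- apply: leq_trans (leq_imset_card (transversal_repr x0 X) _).
  apply/subset_leq_card/subsetP=> _ /imsetP[x X'x ->].
  apply: imset_f; rewrite inE memP /=; apply/card_gt1P.
  exists x, (transversal_repr x0 X (pblock P x)); split.
  + by rewrite mem_pblock covP inE.
  + exact: repr_mem_pblock trX _ _ (memP x).
  apply: contraTneq X'x => ->.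
  by rewrite inE negbK (repr_mem_transversal trX).
- rewrite -{1}(preim_partition_pblock partP).
  apply: eq_preim_partition => x y; apply/eqP/eqP => [-> //|].
  by move/(congr1 (pblock P)); rewrite !(transversal_reprK trX).
Qed.

Lemma mem_perm_setact (T : finType) (g : {perm T}) (A : {set T}) y :
  (y \in ('P^*)%act A g) = (g^-1%g y \in A).
Proof.
rewrite /= setactE -{1}[y](permKV g).
by apply: (mem_imset _ _ (act_inj 'P g)).
Qed.

Lemma setact_preim_partition (T : finType) (g : {perm T}) (rT : eqType)
    (f : T -> rT) :
  ('P^*^*)%act (preim_partition f [set: T]) g
    = preim_partition (fun y => f (g^-1%g y)) [set: T].
Proof.
have defB x : ('P^*)%act [set y in setT | f x == f y] g
    = [set y in setT | f x == f (g^-1%g y)].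
  by apply/setP=> y; rewrite mem_perm_setact !inE.
apply/setP=> B; rewrite /= setactE; apply/imsetP/imsetP.
  case=> _ /imsetP[x _ ->] ->; exists (g x) => //.
  by rewrite defB permK.
case=> x _ ->; exists [set y in setT | f (g^-1%g x) == f y].
  exact: imset_f.
by rewrite defB.
Qed.

(** Factoring the values on [A] through ['I_k] is what makes the number of codes
    [t] grow like [#|T| ^ k] when [k] and [#|A|] are fixed; coding all maps from
    [A] to [T] would give [#|T| ^ #|A|]. *)
Definition collapse (T : finType) (A : {set T}) (k : nat)
    (t : {ffun 'I_k -> T} * {ffun {x | x \in A} -> 'I_k}) (x : T) : T :=
  if insub x is Some u then t.1 (t.2 u) else x.

Lemma preim_partition_collapse (T : finType) (A : {set T}) (f : T -> T) k :
  0 < #|A| -> {in ~: A, f =1 id} -> #|f @: A| <= k ->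
  exists t, preim_partition f [set: T]
    = preim_partition (collapse (A := A) (k := k) t) [set: T].
Proof.
case/card_gt0P=> x0 _ fid lefk.
have ltk (u : {x | x \in A}) : index (f (val u)) (enum (f @: A)) < k.
  apply: leq_trans lefk; rewrite cardE index_mem mem_enum.
  exact: imset_f (valP u).
(* x0 only fills up the list when f takes fewer than k values on A. *)
exists ([ffun i => nth x0 (enum (f @: A)) (val i)],
        [ffun u => Ordinal (ltk u)]).
have eqf x : f x = collapse ([ffun i => nth x0 (enum (f @: A)) (val i)],
                             [ffun u => Ordinal (ltk u)]) x.
  rewrite /collapse; case: insubP => [u Ax <- | A'x] /=.
    by rewrite !ffunE /= nth_index // mem_enum imset_f ?(valP u).
  by rewrite fid // inE.
by apply: eq_preim_partition => x y; rewrite -!eqf.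
Qed.

Lemma card_orbits_le (aT : finGroupType) (T S : finType)
    (to : {action aT &-> T}) (G : {group aT}) (X : {set T}) (h : S -> T) :
  {in X, forall x, exists2 g, g \in G & exists t, to x g = h t} ->
  #|orbit to G @: X| <= #|S|.
Proof.
move=> repX; apply: leq_trans (leq_imset_card (fun t => orbit to G (h t)) S).
apply/subset_leq_card/subsetP=> _ /imsetP[x Xx ->].
have [g Gg [t xg_t]] := repX x Xx.
by apply/imsetP; exists t; rewrite -?xg_t ?orbit_act.
Qed.

Lemma count_partition_type n (P : {set {set 'I_n}}) (p : pred nat) :
  count p (partition_type P) = #|[set B in P | p #|B|]|.
Proof.
rewrite /partition_type (seq.permP (permEl (perm_sort _ _))) count_map.
rewrite cardE -(size_filter _ (enum P)) /enum_mem -filter_predI.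
congr size; apply: eq_filter => B.
by rewrite !inE andbC.
Qed.

Lemma num_partition_orbits_le n r (G : {group {perm 'I_n}}) (lam : seq nat) :
  0 < r -> homogeneous r G ->
  num_partition_orbits G (n - r) lam
    <= count (fun m => 1 < m) lam ^ r * n ^ count (fun m => 1 < m) lam.
Proof.
set k := count _ lam => r_gt0 homG.
have [A0 cardA0 _] := imsetP homG.
have {}cardA0 : #|A0| = r by move: cardA0; rewrite inE => /eqP.
have A0_gt0 : 0 < #|A0| by rewrite cardA0.
have /card_gt0P[x0 _] := A0_gt0.
have le_rn : r <= n by rewrite -cardA0 -[n in _ <= n]card_ord max_card.
have <- : #|{: {ffun 'I_k -> 'I_n} * {ffun {x | x \in A0} -> 'I_k}}|
    = k ^ r * n ^ k.
  by rewrite card_prod !card_ffun card_sig !card_ord cardA0 mulnC.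
apply: (card_orbits_le
  (h := fun t => preim_partition (collapse t) [set: 'I_n])) => P.
rewrite !inE => /andP[/andP[partP /eqP cardP] /eqP typeP].
have [A [f [cardA fid lefA defP]]] := partition_retraction x0 partP.
have {}cardA : #|A| = r by rewrite cardA card_ord cardP subKn.
have [||g Gg defA0] := atransP2 homG (x := A) (y := A0).
- by rewrite inE cardA.
- by rewrite inE cardA0.
exists g => //; rewrite defP setact_preim_partition.
(* The conjugate of f by g has the same fibres as the composite of g^-1 and
   f, and, unlike it, fixes the complement of A0 pointwise. *)
have -> : preim_partition (fun y => f (g^-1%g y)) [set: 'I_n]
    = preim_partition (fun y => g (f (g^-1%g y))) [set: 'I_n].
  by apply: eq_preim_partition => x y; rewrite (inj_eq perm_inj).
apply: preim_partition_collapse => // [x|].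
  rewrite inE defA0 mem_perm_setact => A'x.
  by rewrite fid ?inE //= permKV.
have -> : [set g (f (g^-1%g y)) | y in A0] = g @: (f @: A).
  rewrite defA0 /= setactE -!imset_comp; apply: eq_imset => x /=.
  by rewrite apermE permK.
rewrite card_imset; last exact: perm_inj.
by rewrite /k -typeP count_partition_type.
Qed.

(* Subtraction is truncated, but the part sizes of a partition sum to n, so
   the three families are empty when n < 4, n < 5, n < 6 respectively. *)
Theorem theorem2p8 :
  [/\ exists C : nat, forall (n : nat) (G : {group {perm 'I_n}}),
        homogeneous 3 G ->
        num_partition_orbits G (n - 3) (4 :: nseq (n - 4) 1) <= C * n,
      exists C : nat, forall (n : nat) (G : {group {perm 'I_n}}),
        homogeneous 3 G ->
        num_partition_orbits G (n - 3) ([:: 3; 2] ++ nseq (n - 5) 1)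
          <= C * n ^ 2
    & exists C : nat, forall (n : nat) (G : {group {perm 'I_n}}),
        homogeneous 3 G ->
        num_partition_orbits G (n - 3) ([:: 2; 2; 2] ++ nseq (n - 6) 1)
          <= C * n ^ 3].
Proof.
split; [exists (1 ^ 3) | exists (2 ^ 3) | exists (3 ^ 3)] => n G homG;
  apply: leq_trans (num_partition_orbits_le _ _ homG) _ => //;
  by rewrite /= count_nseq.
Qed.
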